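(* Let $\mathcal{K}$ be the class of $\mathcal{L}$-structures $(C(X),\tau)$ with $X$ a finite discrete space and $\tau$ an automorphism of $C(X)$, and let $(C(2^{\mathbb{N}}),\sigma)$ be its Fra\''iss\'e limit, with $\sigma$ induced by a homeomorphism of the Cantor set. Then this homeomorphism $\sigma$ does not have the lifting property; in particular it is not conjugate to the generic homeomorphism of the Cantor set.
   Context: $\mathcal{L}$ is the language of unital C*-algebras (continuous logic) expanded by a unary function symbol for an automorphism; a homeomorphism $S$ of $X$ corresponds to $(C(X),\sigma)$, $\sigma(f)=f\circ S$. The class $\mathcal{K}$ is a Fra\''iss\'e class (in the sense of Fra\''iss\'e theory for metric structures) whose limit has the stated form. Spirals: for $n\ge1$ let $S_n=L_n\cup M_n\cup\tilde R_n$ with $L_n=\{l\}\times\{0,\dots,n!-1\}$, $\tilde R_n=\{r\}\times\{0,\dots,n!-1\}$, $M_n=\{m\}\times\{-n+1,\dots,n-1\}$, and relation $R_n$: $(l,k)R_n(l,k+1)$, $(r,k)R_n(r,k+1)$ for $0\le k<n!-1$; $(l,n!-1)R_n(l,0)$; $(r,n!-1)R_n(r,0)$; $(m,k)R_n(m,k+1)$ for $-n+1\le k<n-1$; $(l,0)R_n(m,-n+1)$; $(m,n-1)R_n(r,0)$. Maps $S_{n+1}\to S_n$: $\xi_L(a,k)=(l,k\bmod n!)$, $\xi_G(a,k)=(r,k\bmod n!)$, $\xi_M(a,k)=(a,k\bmod n!)$ for $a\in\{l,r\}$, $\xi_M(m,k)=(m,k)$ for $|k|\le n-1$, $\xi_M(m,-n)=(l,0)$,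 $\xi_M(m,n)=(r,0)$. $W_n$ is the disjoint union of $6^n$ copies of $S_n$ indexed by words of length $n$ over $\{L_1,L_2,M_1,M_2,G_1,G_2\}$ (discrete, $R_n$ the union of relations); $\xi:W_{n+1}\to W_n$ maps the copy indexed by $wa$ to the copy indexed by $w$ via $\xi_L,\xi_M,\xi_G$ according as $a\in\{L_1,L_2\},\{M_1,M_2\},\{G_1,G_2\}$; composites give $\xi:W_{n+k}\to W_n$. $\phi:(X,\sigma)\to(W_n,R_n)$ means a continuous surjection with $\phi(x)R_n\phi(\sigma x)$ for all $x$; $A_\phi$ is its partition into fibres. A Cantor system $(X,\sigma)$ (with compatible metric) has the lifting property if for every $\epsilon>0$, $n$, and $\phi:(X,\sigma)\to(W_n,R_n)$ there are $k\ge1$ and $\psi:(X,\sigma)\to(W_{n+k},R_{n+k})$ with all members of $A_\psi$ of diameter $<\epsilon$ and $\phi=\xi\circ\psi$. The generic homeomorphism of the Cantor set (the one with comeagre conjugacy class in the homeomorphism group) is, up to conjugacy, the unique homeomorphism with the lifting property (Akin–Glasner–Weiss).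
   Formalization: The lifting property is also required at n = 0, with S_0 a single fixed point; with n ≥ 1 only, the Fraïssé limit maps onto no W_n and would have the property vacuously. Non-lifting is proved for the printed spirals and for those with middle arm of half-length n!. *)

(* Defs.v *)
From HB Require Import structures.
From mathcomp Require Import all_boot all_order all_algebra.
From mathcomp Require Import all_classical all_reals all_analysis.
From mathcomp Require Import complex.
Set Implicit Arguments.
Unset Strict Implicit.
Unset Printing Implicit Defensive.
Import Order.TTheory GRing.Theory Num.Theory.
Import numFieldNormedType.Exports.
Local Open Scope classical_set_scope.
Local Open Scope ring_scope.
Local Open Scope complex_scope.

Definition Cfun (R : realType) (X : ptopologicalType) : Type :=
  continuousType X (R[i]^o).

HB.instance Definition _ (R : realType) (X : ptopologicalType) :=
  gen_eqMixin (Cfun R X).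
HB.instance Definition _ (R : realType) (X : ptopologicalType) :=
  gen_choiceMixin (Cfun R X).

Section Cfun_algebra.
Context {R : realType} {X : ptopologicalType}.
Implicit Types (f g h : Cfun R X) (a : R[i]).

Definition mkCfun (f : X -> R[i]^o) (cf : continuous f) : Cfun R X := mkcts cf.

Lemma CfunP f g : f = g <-> f =1 g.
Proof. exact: continuousEP. Qed.

Lemma conjc_continuous : continuous (conjc : R[i]^o -> R[i]^o).
Proof.
move=> x A /nbhs_ballP[e e0 xeA]; apply/nbhs_ballP; exists e => // y xey.
apply: xeA; move: xey; rewrite /ball /= -rmorphB.
by rewrite (norm_conjC (x - y)).
Qed.

Fact Cfun_cst_subproof a : continuous (fun _ : X => a : R[i]^o).
Proof. by move=> x; exact: cvg_cst. Qed.
Fact Cfun_add_subproof f g : continuous (fun x => f x + g x : R[i]^o).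
Proof. by move=> x; apply: (@cvgD _ _ X); exact: cts_fun. Qed.
Fact Cfun_opp_subproof f : continuous (fun x => - f x : R[i]^o).
Proof. by move=> x; apply: (@cvgN _ _ X); exact: cts_fun. Qed.
Fact Cfun_mul_subproof f g : continuous (fun x => f x * g x : R[i]^o).
Proof. by move=> x; apply: (@cvgM _ X); exact: cts_fun. Qed.
Fact Cfun_star_subproof f : continuous (fun x => conjc (f x) : R[i]^o).
Proof.
by move=> x; apply: continuous_comp; [exact: cts_fun|exact: conjc_continuous].
Qed.

Definition Cfun_cst a := mkCfun (@Cfun_cst_subproof a).
Definition Cfun_add f g := mkCfun (@Cfun_add_subproof f g).
Definition Cfun_opp f := mkCfun (@Cfun_opp_subproof f).
Definition Cfun_mul f g := mkCfun (@Cfun_mul_subproof f g).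
Definition Cfun_scale a f := Cfun_mul (Cfun_cst a) f.
Definition Cfun_star f := mkCfun (@Cfun_star_subproof f).


Fact Cfun_addA : associative Cfun_add.
Proof. by move=> f g h; apply/CfunP => x; exact: addrA. Qed.
Fact Cfun_addC : commutative Cfun_add.
Proof. by move=> f g; apply/CfunP => x; exact: addrC. Qed.
Fact Cfun_add0 : left_id (Cfun_cst 0) Cfun_add.
Proof. by move=> f; apply/CfunP => x; exact: add0r. Qed.
Fact Cfun_addN : left_inverse (Cfun_cst 0) Cfun_opp Cfun_add.
Proof. by move=> f; apply/CfunP => x; exact: addNr. Qed.

HB.instance Definition _ :=
  GRing.isZmodule.Build (Cfun R X) Cfun_addA Cfun_addC Cfun_add0 Cfun_addN.

Fact Cfun_mulA : associative Cfun_mul.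
Proof. by move=> f g h; apply/CfunP => x; exact: mulrA. Qed.
Fact Cfun_mulC : commutative Cfun_mul.
Proof. by move=> f g; apply/CfunP => x; exact: mulrC. Qed.
Fact Cfun_mul1 : left_id (Cfun_cst 1) Cfun_mul.
Proof. by move=> f; apply/CfunP => x; exact: mul1r. Qed.
Fact Cfun_mulDl : left_distributive Cfun_mul Cfun_add.
Proof. by move=> f g h; apply/CfunP => x; exact: mulrDl. Qed.
Fact Cfun_1_neq0 : Cfun_cst 1 != Cfun_cst 0.
Proof.
apply/eqP => /CfunP /(_ point) /= /eqP; apply/negP; exact: oner_neq0.
Qed.

HB.instance Definition _ := GRing.Zmodule_isComNzRing.Build (Cfun R X)
  Cfun_mulA Cfun_mulC Cfun_mul1 Cfun_mulDl Cfun_1_neq0.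

Fact Cfun_scaleA a b f : Cfun_scale a (Cfun_scale b f) = Cfun_scale (a * b) f.
Proof. by apply/CfunP => x; exact: mulrA. Qed.
Fact Cfun_scale1 : left_id 1 Cfun_scale.
Proof. by move=> f; apply/CfunP => x; exact: mul1r. Qed.
Fact Cfun_scaleDr : right_distributive Cfun_scale +%R.
Proof. by move=> a f g; apply/CfunP => x; exact: mulrDr. Qed.
Fact Cfun_scaleDl f : {morph Cfun_scale^~ f : a b / a + b}.
Proof. by move=> a b; apply/CfunP => x; exact: mulrDl. Qed.

HB.instance Definition _ := GRing.Zmodule_isLmodule.Build R[i] (Cfun R X)
  Cfun_scaleA Cfun_scale1 Cfun_scaleDr Cfun_scaleDl.

Fact Cfun_scaleAl a f g : a *: (f * g) = (a *: f) * g.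
Proof. exact: Cfun_mulA. Qed.

HB.instance Definition _ :=
  GRing.Lmodule_isLalgebra.Build R[i] (Cfun R X) Cfun_scaleAl.
HB.instance Definition _ :=
  GRing.Lalgebra_isComAlgebra.Build R[i] (Cfun R X).

End Cfun_algebra.

Definition sup_norm (R : realType) (X : ptopologicalType) (f : Cfun R X) : R :=
  sup [set Normc.normc (f x) | x in [set: X]].

(* A structure in the language of unital C*-algebras with a unary function
   symbol [Laut]. The C*-axioms, and the axiom that [Laut] is an automorphism,
   are not fields: they hold in the structures [Cstructure tau], for X compact
   and tau an automorphism, which are the only ones considered. *)
Record Lstructure (R : realType) := MkLstructure {
  Lalg :> algType R[i];
  Lstar : Lalg -> Lalg;
  Lnorm : Lalg -> R;
  Laut : Lalg -> Lalg }.

Record embedding (R : realType) (A B : Lstructure R) := Embedding {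
  emb_fun :> {lrmorphism A -> B};
  emb_star : forall a, emb_fun (Lstar a) = Lstar (emb_fun a);
  emb_norm : forall a, Lnorm (emb_fun a) = Lnorm a;
  emb_aut : forall a, emb_fun (Laut a) = Laut (emb_fun a) }.

Section Fraisse_limit.
Context {R : realType} (K : Lstructure R -> Prop) (M : Lstructure R).

(* For M complete, this says that M is the limit of the sequence A. *)
Definition inductive_limit := exists (A : nat -> Lstructure R)
    (i : forall n, embedding (A n) (A n.+1)) (j : forall n, embedding (A n) M),
  [/\ forall n, K (A n),
      forall n a, j n.+1 (i n a) = j n a
    & forall (b : M) (e : R), 0 < e -> exists n a, Lnorm (j n a - b) < e].

Definition universal := forall A : Lstructure R, K A -> inhabited (embedding A M).

Definition approximately_homogeneous :=
  forall (A : Lstructure R) (f g : embedding A M) (s : seq A) (e : R),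
    K A -> 0 < e ->
    exists h : embedding M M, bijective h /\
      forall a, a \in s -> Lnorm (h (f a) - g a) < e.

Definition Fraisse_limit :=
  [/\ inductive_limit, universal & approximately_homogeneous].

End Fraisse_limit.

Definition Cstructure (R : realType) (X : ptopologicalType)
    (tau : Cfun R X -> Cfun R X) : Lstructure R :=
  @MkLstructure R (Cfun R X) (@Cfun_star R X) (@sup_norm R X) tau.

(* Spaces are nonempty, as [pdiscreteTopologicalType] is pointed: the unit of
   C(X) has to be nonzero. *)
Definition classK (R : realType) (A : Lstructure R) : Prop :=
  exists (X : pdiscreteTopologicalType)
         (tau : {lrmorphism Cfun R X -> Cfun R X}),
    [/\ finite_set [set: X],
        forall f, tau (Cfun_star f) = Cfun_star (tau f),
        bijective tau
      & A = Cstructure tau].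

Definition is_homeo (X : topologicalType) (f : X -> X) : Prop :=
  continuous f /\
  exists g : X -> X, [/\ continuous g, cancel f g & cancel g f].

(* [set_type] equips this with the topology induced by the compact-open one. *)
Definition homeo (X : topologicalType) : Type :=
  set_type [set f : {compact-open, X -> X} | is_homeo f].

HB.instance Definition _ (X : topologicalType) := Topological.on (homeo X).

Definition homeo_fun (X : topologicalType) (S : homeo X) : X -> X := set_val S.
Coercion homeo_fun : homeo >-> Funclass.

Lemma homeo_continuous (X : topologicalType) (S : homeo X) :
  continuous (S : X -> X).
Proof. by case: S => f fP; have [] := set_mem fP. Qed.

Definition conjugate (X : topologicalType) (S T : homeo X) : Prop :=
  exists h : homeo X, forall x, h (S x) = T (h x).

Definition comeagre (T : topologicalType) (A : set T) : Prop :=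
  exists U : nat -> set T,
    (forall n, open (U n) /\ dense (U n)) /\ \bigcap_n U n `<=` A.

Definition generic (X : topologicalType) (T : homeo X) : Prop :=
  comeagre [set S : homeo X | conjugate T S].

Section Cfun_comp.
Context {R : realType} {X : ptopologicalType} (S : homeo X).

Fact Cfun_comp_subproof (f : Cfun R X) : continuous (fun x => f (S x)).
Proof.
move=> x; apply: (@continuous_comp X X) => //; first exact: homeo_continuous.
exact: cts_fun.
Qed.

Definition Cfun_comp (f : Cfun R X) : Cfun R X := mkCfun (@Cfun_comp_subproof f).

End Cfun_comp.

Variant side := SL | SM | SR.
HB.instance Definition _ := gen_eqMixin side.
HB.instance Definition _ := gen_choiceMixin side.

Local Notation spoint := (side * int)%type.
Local Notation letter := (side * bool)%type.

Section spirals.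

(* The middle arm of the n-th spiral is {m} x {-arm n + 1, ..., arm n - 1}.
   With arm n = n, [xi_spiral n] does not preserve the relations for n >= 2: it
   can send the edge (l, 0) -> (m, -n) to (l, 0) -> (l, 0). With arm n = n! it
   does preserve them. *)
Variable arm : nat -> nat.

(* For n = 0 the general formula makes no sense. The 0-th spiral is a fixed
   point, so that W_0 is trivial and every homeomorphism maps onto it. *)
Definition spiral (n : nat) : set spoint :=
  if n is 0%N then [set (SL, 0)] else
  [set p | match p with
           | (SM, k) => - (arm n)%:Z < k < (arm n)%:Z
           | (_, k) => 0 <= k < n`!%:Z
           end].

Inductive spiral_rel_pos (n : nat) : spoint -> spoint -> Prop :=
| Rel_l k : 0 <= k < n`!%:Z - 1 -> spiral_rel_pos n (SL, k) (SL, k + 1)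
| Rel_r k : 0 <= k < n`!%:Z - 1 -> spiral_rel_pos n (SR, k) (SR, k + 1)
| Rel_l0 : spiral_rel_pos n (SL, n`!%:Z - 1) (SL, 0)
| Rel_r0 : spiral_rel_pos n (SR, n`!%:Z - 1) (SR, 0)
| Rel_m k : - (arm n)%:Z + 1 <= k < (arm n)%:Z - 1 ->
    spiral_rel_pos n (SM, k) (SM, k + 1)
| Rel_lm : spiral_rel_pos n (SL, 0) (SM, - (arm n)%:Z + 1)
| Rel_mr : spiral_rel_pos n (SM, (arm n)%:Z - 1) (SR, 0).

Definition spiral_rel (n : nat) (p q : spoint) : Prop :=
  if n is 0%N then p = (SL, 0) /\ q = (SL, 0) else spiral_rel_pos n p q.

(* xi_L, xi_M and xi_G; the letter G is encoded by [SR]. *)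
Definition xi_spiral (n : nat) (a : side) (p : spoint) : spoint :=
  if n is 0%N then (SL, 0) else
  match a, p with
  | SL, (_, k) => (SL, (k %% n`!)%Z)
  | SR, (_, k) => (SR, (k %% n`!)%Z)
  | SM, (SM, k) =>
      if k <= - (arm n)%:Z then (SL, ((k + arm n) %% n`!)%Z)
      else if (arm n)%:Z <= k then (SR, ((k - (arm n)%:Z) %% n`!)%Z)
      else (SM, k)
  | SM, (b, k) => (b, (k %% n`!)%Z)
  end.

(* A point of W_n is a word paired with a point of the n-th spiral; the letters
   L_1, L_2, M_1, M_2, G_1, G_2 are the elements of [letter]. *)
Definition wpoint : Type := discrete_topology (seq letter * spoint)%type.

HB.instance Definition _ := DiscreteTopology.on wpoint.

Definition W (n : nat) : set wpoint :=
  [set p | size p.1 = n /\ spiral n p.2].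

Definition W_rel (n : nat) (p q : wpoint) : Prop :=
  p.1 = q.1 /\ spiral_rel n p.2 q.2.

(* xi : W_{n+1} -> W_n drops the last letter; empty words do not occur. *)
Definition xi (n : nat) (p : wpoint) : wpoint :=
  if p.1 is a :: w then (belast a w, xi_spiral n (last a w).1 p.2) else p.

(* The composite W_{n+k} -> W_n. *)
Fixpoint xi_iter (n k : nat) (p : wpoint) : wpoint :=
  if k is k'.+1 then xi_iter n k' (xi (n + k') p) else p.

Definition W_map (X : topologicalType) (S : homeo X) (n : nat)
    (phi : X -> wpoint) : Prop :=
  [/\ continuous phi, range phi = W n & forall x, W_rel n (phi x) (phi (S x))].

Definition compatible_metric (R : realType) (X : topologicalType)
    (d : X -> X -> R) : Prop :=
  [/\ forall x y, d x y = 0 <-> x = y,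
      forall x y, d x y = d y x,
      forall x y z, d x z <= d x y + d y z
    & forall x (A : set X),
        nbhs x A <-> exists2 e, 0 < e & [set y | d x y < e] `<=` A].

Definition diam (R : realType) (X : Type) (d : X -> X -> R) (A : set X) :
    \bar R := ereal_sup [set (d x y)%:E | x in A & y in A].

Definition lifting_property (R : realType) (X : topologicalType)
    (d : X -> X -> R) (S : homeo X) : Prop :=
  forall (e : R) (n : nat) (phi : X -> wpoint),
    0 < e -> W_map S n phi ->
    exists (k : nat) (psi : X -> wpoint),
      [/\ (1 <= k)%N, W_map S (n + k) psi,
          forall w, W (n + k) w -> (diam d (psi @^-1` [set w]) < e%:E)%E
        & forall x, phi x = xi_iter n k (psi x)].

End spirals.

(* Main.v *)
(* A finite system is periodic, so the homeomorphism S of the Fraisse limit,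
   an inverse limit of finite systems, returns each clopen set into itself
   after some positive number of steps ("locally periodic"). This rules out a
   trap: a clopen P with S(P) in P and a point outside P sent into P.

   The lifting property, applied to the trivial map onto W_0, gives a map onto
   some W_n with n > 0, where the points past the centre of the middle arms and
   those of the right cycles form a trap.

   Having a given trap is an open condition on a homeomorphism of the Cantor
   set, satisfied by some homeomorphism; the homeomorphism group being a Baire
   space, every comeagre class contains a homeomorphism with a trap, and local
   periodicity is invariant under conjugacy. *)
Require Import Defs.
From HB Require Import structures.
From mathcomp Require Import all_boot all_order all_algebra.
From mathcomp Require Import all_classical all_reals all_analysis.
From mathcomp Require Import complex.
Import Order.TTheory GRing.Theory Num.Theory.
Import numFieldNormedType.Exports.
Local Open Scope classical_set_scope.
Local Open Scope ring_scope.
Set Implicit Arguments.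
Unset Strict Implicit.
Unset Printing Implicit Defensive.

Lemma prod_sub_scalar_eq0 (R : realType) (X : ptopologicalType)
    (f : Cfun R X) (s : seq R[i]) :
  \prod_(v <- s) (f - v%:A) = 0 <-> forall x, f x \in s.
Proof.
have ev x : (\prod_(v <- s) (f - v%:A)) x = \prod_(v <- s) (f x - v).
  elim: s => [|v s IH]; first by rewrite !big_nil.
  rewrite !big_cons -IH.
  change ((f x - v * 1) * (\prod_(j <- s) (f - j%:A)) x =
    (f x - v) * (\prod_(j <- s) (f - j%:A)) x).
  by rewrite mulr1.
split=> [p0 x|fs].
  have := ev x; rewrite p0 => /esym/eqP.
  rewrite prodf_seq_eq0 => /hasP[v vs /=].
  by rewrite subr_eq0 => /eqP ->.
apply/CfunP => x; rewrite ev; apply/eqP; rewrite prodf_seq_eq0.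
by apply/hasP; exists (f x) => //=; rewrite subrr.
Qed.

Lemma finite_orbit (T : finType) (U : Type) (u : nat -> U) (c : U -> T) :
  (forall i j, c (u i) = c (u j) -> u i = u j) ->
  exists i j, (i < j)%N /\ u i = u j.
Proof.
move=> cu; pose h (i : 'I_#|T|.+1) := c (u i).
have /injectivePn[i [j ij hij]] : ~~ injectiveb h.
  by apply/negP => /injectiveP /leq_card; rewrite card_ord ltnn.
move: ij; rewrite -val_eqE neq_ltn => /orP[]ij.
- by exists i, j; split=> //; exact: cu.
- by exists j, i; split=> //; apply: cu.
Qed.

(* [a] is a root of the product of the [a - v], over the values [v] of [a];
   so are all its images under the automorphism, which therefore take values
   in a fixed finite set. *)
Lemma classK_periodic (R : realType) (A : Lstructure R) (a : A) :
  classK A -> exists2 N, (0 < N)%N & iter N (@Laut R A) a = a.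
Proof.
move=> [X [tau [finX _ tauB eA]]]; subst A; move: a => /= a.
have [t tE] : exists t : seq X, [set: X] = [set` t].
  by have /finite_seqP := finX.
have tX x : x \in t by have : [set` t] x by rewrite -tE.
pose s := [seq a x | x <- t].
have orb k x : (iter k tau a) x \in s.
  move: x; apply/prod_sub_scalar_eq0; elim: k => [|k IH] /=.
    by apply/prod_sub_scalar_eq0 => x; exact: map_f.
  rewrite -[RHS](rmorph0 tau) -IH rmorph_prod; apply: eq_bigr => v _.
  by rewrite rmorphB; congr (_ - _); exact/esym/(rmorph_alg tau).
pose c (f : Cfun R X) :=
  [ffun i : 'I_(size t) =>
     inord (index (f (tnth (in_tuple t) i)) s) : 'I_(size s).+1].
have cinj i j :
    c (iter i tau a) = c (iter j tau a) -> iter i tau a = iter j tau a.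
  move=> cij; apply/CfunP => x.
  have /seq_tnthP[l ->] := tX x.
  have /(congr1 val) := congr1 (fun g : {ffun _ -> _} => g l) cij.
  rewrite !ffunE /= !inordK ?ltnS ?index_size //.
  move=> /(congr1 (nth 0 s)).
  by rewrite !nth_index //; exact: orb.
have [i [j [ij e]]] := finite_orbit cinj.
exists (j - i)%N; first by rewrite subn_gt0.
apply: (@bij_inj _ _ (iter i tau)).
  by elim: {+}i => [|k IH] /=; [exists id|exact: bij_comp].
by rewrite -iterD subnKC // ltnW.
Qed.

Lemma normc_le_sup_norm (R : realType) (X : ptopologicalType) (f : Cfun R X) :
  compact [set: X] -> forall x, Normc.normc (f x) <= sup_norm f.
Proof.
move=> cX x; apply: ub_le_sup; last by exists x.
have /(_ nat \oo (fun n y => Normc.normc (f y) < n%:R)) :=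
  proj1 (compact_near_coveringP _) cX.
case=> [y _|N _ /(_ N (leqnn N)) fN].
  have fy : \forall z \near y, `|f y - f z| < 1.
    by have /cvgrPdist_lt := @cts_fun _ _ f y; apply; exact: ltr01.
  have [M yM] : exists M : nat, Normc.normc (f y) + 1 < M%:R.
    exists (Num.trunc (Normc.normc (f y) + 1)).+1; exact: truncnS_gt.
  exists ([set z | `|f y - f z| < 1], [set n | (M <= n)%N]).
    by split=> //; exists M.
  move=> [z n] /= [yz Mn].
  apply: (@lt_le_trans _ _ M%:R); last by rewrite ler_nat.
  apply: le_lt_trans yM.
  rewrite -lerBlDl -lecR rmorphB /=.
  have -> : (Normc.normc (f z))%:C%C = `|f z| by [].
  have -> : (Normc.normc (f y))%:C%C = `|f y| by [].
  by apply: le_trans (ltW yz); rewrite distrC; exact: lerB_dist.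
by exists N%:R => _ [y _ <-]; apply/ltW/fN.
Qed.

Definition locally_periodic (X : topologicalType) (S : X -> X) : Prop :=
  forall B : set X, clopen B ->
    exists2 N, (0 < N)%N & forall x, B x -> B (iter N S x).

Lemma clopen_indicator_continuous (R : realType) (X : ptopologicalType)
    (B : set X) :
  clopen B -> continuous (fun x => (x \in B)%:R : R[i]^o).
Proof.
move=> [oB cB] x; have [xB|xB] := pselect (B x).
- have nB : \forall z \near x, B z by exact: open_nbhs_nbhs.
  apply: cvg_near_cst.
  by near=> z; rewrite !mem_set //; near: z.
- have nB : \forall z \near x, (~` B) z.
    by apply: open_nbhs_nbhs; split=> //; exact: closed_openC.
  apply: cvg_near_cst.
  by near=> z; rewrite !memNset //; near: z.
Unshelve. all: by end_near. Qed.

Lemma iter_Cfun_comp (R : realType) (X : ptopologicalType) (S : homeo X)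
    (f : Cfun R X) n x :
  iter n (Cfun_comp S) f x = f (iter n S x).
Proof. by elim: n x => // n IH x; rewrite [in RHS]iterSr -IH. Qed.

Lemma inductive_limit_locally_periodic (R : realType) (X : ptopologicalType)
    (S : homeo X) :
  compact [set: X] ->
  inductive_limit (@classK R) (Cstructure (@Cfun_comp R X S)) ->
  locally_periodic S.
Proof.
move=> cX [A [i [j [KA _ dj]]]] B clB.
pose b : Cfun R X := mkCfun (clopen_indicator_continuous clB).
have [n [a anb]] := dj b 2^-1 ltac:(by rewrite invr_gt0).
have [N N0 aN] := classK_periodic a (KA n).
exists N => // x Bx.
pose g : Cfun R X := j n a.
have gN : g (iter N S x) = g x.
  have E k : iter k (Cfun_comp S) g = j n (iter k (@Laut _ _) a).
    elim: k => [//|k IH]; rewrite !iterS IH.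
    exact/esym/(emb_aut (j n)).
  by rewrite -iter_Cfun_comp E aN.
have gb y : Normc.normc (g y - (y \in B)%:R) < 2^-1.
  by apply: le_lt_trans anb; exact: (@normc_le_sup_norm _ _ (g - b)).
apply: contrapT => BN; move: (gb x) (gb (iter N S x)).
rewrite gN mem_set // memNset // subr0 => g1 g0.
have : Normc.normc (g x - (g x - 1)) < 1.
  rewrite [ltRHS]splitr mul1r.
  apply: le_lt_trans (ltrD g0 g1); rewrite -lecR rmorphD /=.
  exact: (ler_normB (g x : R[i]) (g x - 1)).
by rewrite subKr Normc.normc1 ltxx.
Qed.

Lemma locally_periodic_trap (X : topologicalType) (S : X -> X) (P : set X) x :
  locally_periodic S -> clopen P -> (forall y, P y -> P (S y)) ->
  ~ P x -> ~ P (S x).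
Proof.
move=> perS clP SP xP Sx.
have [[//|N] _ /(_ x xP)] := perS (~` P) (clopenC P clP).
by apply; elim: N => //= N; exact: SP.
Qed.

Lemma locally_periodic_conjugate (X : topologicalType) (S T : homeo X) :
  conjugate S T -> locally_periodic S -> locally_periodic T.
Proof.
move=> [h hS] perS B [oB cB].
have cth := @homeo_continuous X h.
have [|N N0 NP] := perS (h @^-1` B).
  by split; [exact: open_comp|exact: closed_comp].
exists N => // y By.
have [_ [g [_ _ hgK]]] : is_homeo h by exact: (set_valP h).
have hN x : iter N T (h x) = h (iter N S x).
  by elim: N {N0 NP} => //= N ->; rewrite hS.
by rewrite -(hgK y) hN; apply: NP; rewrite /= hgK.
Qed.

Lemma W_map0 arm (X : topologicalType) (S : homeo X) (x : X) :
  W_map arm S 0 (fun=> ([::], (SL, 0))).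
Proof.
split=> //; first by move=> y; exact: cvg_cst.
apply/seteqP; split=> [_ [y _ <-]//|[w p] [/= /size0nil -> ->]].
by exists x.
Qed.

Lemma lifting_property_not_locally_periodic (R : realType) arm
    (X : topologicalType) (d : X -> X -> R) (S : homeo X) (x : X) :
  (forall n, (0 < n)%N -> (0 < arm n)%N) ->
  lifting_property arm d S -> ~ locally_periodic S.
Proof.
move=> arm0 lift perS.
have [k [psi [k0 [cpsi rpsi relpsi] _ _]]] :=
  lift 1 0%N _ ltr01 (W_map0 arm S x).
have {}k0 : (0 < 0 + k)%N by [].
move: (0 + k)%N k0 cpsi rpsi relpsi => n n0 cpsi rpsi relpsi.
pose Q (p : wpoint) := match p.2 with
  | (SL, _) => False | (SM, i) => 0 < i | (SR, _) => True end.
have QS y z : W_rel arm n y z -> Q y -> Q z.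
  rewrite /Q; case: n {n0 cpsi rpsi relpsi} => [|n];
    case: y z => [? p] [? q] [_ /=].
    by case=> -> ->.
  by case=> //= i _ i0; exact: addr_gt0.
have clQ : clopen (psi @^-1` Q).
  split; first by apply: open_comp => //; exact: discrete_open.
  by apply: closed_comp => //; exact: discrete_closed.
have [y _ yE] : range psi (nseq n (SL, true), (SM, 0)).
  rewrite rpsi; split; first by rewrite /= size_nseq.
  case: n n0 {cpsi rpsi relpsi clQ QS} => //= n _.
  by rewrite oppr_lt0 !ltz_nat arm0.
apply: (locally_periodic_trap perS clQ (x := y)).
- by move=> z; apply: QS.
- by rewrite /= yE.
- have := relpsi y; rewrite /= yE; case: (psi (S y)) => w q [_ /=].
  case: n n0 {cpsi rpsi relpsi clQ QS yE} => //= n _ r.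
  by inversion r; rewrite /Q /= ?add0r.
Qed.

Definition agree (m : nat) (x y : cantor_space) : Prop :=
  forall i, (i < m)%N -> x i = y i.

Lemma agree_sym m x y : agree m x y -> agree m y x.
Proof. by move=> xy i im; rewrite xy. Qed.

Lemma agree_trans m x y z : agree m x y -> agree m y z -> agree m x z.
Proof. by move=> xy yz i im; rewrite xy // yz. Qed.

Lemma agree_leq m n x y : (m <= n)%N -> agree n x y -> agree m x y.
Proof. by move=> mn xy i im; apply: xy; exact: leq_trans mn. Qed.

Lemma near_coord i (x : cantor_space) : \forall y \near x, y i = x i.
Proof.
have /= := @proj_continuous nat (fun=> bool) i x.
by move=> /discrete_cvg; apply.
Qed.

Lemma near_forall_ltn (T : Type) (F : set_system T) (P : nat -> T -> Prop) m :
  Filter F -> (forall i, F (P i)) -> F (fun y => forall i, (i < m)%N -> P i y).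
Proof.
move=> FF FP; elim: m => [|m IH].
  by apply: filterS filterT => y _ i; rewrite ltn0.
apply: filterS2 (FP m) IH => y Pm Py i.
by rewrite ltnS leq_eqVlt => /predU1P[->//|]; exact: Py.
Qed.

Lemma near_agree m (x : cantor_space) : \forall y \near x, agree m y x.
Proof.
by apply: near_forall_ltn => i; exact: near_coord.
Qed.

Lemma nbhs_agree (x : cantor_space) (A : set cantor_space) :
  nbhs x A -> exists m, forall y, agree m y x -> A y.
Proof.
pose F : set_system cantor_space :=
  filter_from setT (fun m => [set y | agree m y x]).
have FF : Filter F.
  apply: filter_from_filter; first by exists 0%N.
  move=> i j _ _; exists (maxn i j) => // y xy.
  by split; apply: agree_leq xy; rewrite ?leq_maxl ?leq_maxr.
have : F --> x.
  apply/cvg_sup => i U [_ [[V oV <-] Vx] /filterS]; apply.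
  by exists i.+1 => // y /= /(_ i (ltnSn i)) yx; rewrite /= /proj yx.
by move=> /[apply] -[m _ mA]; exists m => y /mA.
Qed.

Lemma continuous_coord (T : topologicalType) (f : T -> cantor_space) :
  (forall x i, \forall y \near x, f y i = f x i) -> continuous f.
Proof.
move=> fc x A /nbhs_agree[m mA].
have : \forall y \near x, agree m (f y) (f x).
  by apply: near_forall_ltn => i; exact: fc.
by apply: filterS => y /mA.
Qed.

Lemma near_agree_comp (f : cantor_space -> cantor_space) x i : continuous f ->
  exists m, forall y, agree m y x -> f y i = f x i.
Proof.
move=> fc; apply: (@nbhs_agree x [set y | f y i = f x i]).
exact: (fc x _ (near_coord i (f x))).
Qed.

Lemma compact_open_agree (f : cantor_space -> cantor_space)
    (U : set {compact-open, cantor_space -> cantor_space}) :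
  continuous f -> open U -> U f ->
  exists m, forall g, (forall x, agree m (g x) (f x)) -> U g.
Proof.
move=> cf oU Uf.
pose F : set_system {compact-open, cantor_space -> cantor_space} :=
  filter_from setT (fun m => [set g | forall x, agree m (g x) (f x)]).
have FF : Filter F.
  apply: filter_from_filter; first by exists 0%N.
  move=> i j _ _; exists (maxn i j) => // y xy.
  by split=> z; apply: agree_leq (xy z); rewrite ?leq_maxl ?leq_maxr.
suff : F --> (f : {compact-open, cantor_space -> cantor_space}).
  move=> /(_ U)[|m _ mU]; first by apply: open_nbhs_nbhs; split.
  by exists m => g /mU.
apply/compact_open_cvgP => K O cK oO fKO.
have /(_ nat \oo (fun m y => forall z, agree m z y -> O z)) :=
  proj1 (compact_near_coveringP _)
    (continuous_compact (continuous_subspaceT cf) cK).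
case=> [y /fKO Oy|m _ mO].
  have [m mO] := nbhs_agree (open_nbhs_nbhs (conj oO Oy)).
  exists ([set y' | agree m y' y], [set n | (m <= n)%N]).
    by split; [exact: near_agree|exists m].
  move=> [y' n] /= [y'y mn] z zy'; apply: mO; apply: agree_trans y'y.
  exact: agree_leq zy'.
exists m => // g gf _ [x Kx <-].
by apply: (mO m (leqnn m) (f x)); [exists x|exact: gf].
Qed.

Lemma homeoP (X : topologicalType) (S : homeo X) : is_homeo S.
Proof. exact: (set_valP S). Qed.

Definition homeo_inv (X : topologicalType) (S : homeo X) : X -> X :=
  projT1 (cid (proj2 (homeoP S))).

Lemma homeo_invP (X : topologicalType) (S : homeo X) :
  [/\ continuous (homeo_inv S), cancel S (homeo_inv S)
    & cancel (homeo_inv S) S].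
Proof. by rewrite /homeo_inv; case: cid. Qed.

Definition homeo_mk (X : topologicalType) (f : X -> X) (hf : is_homeo f) :
  homeo X := exist _ f (mem_set hf).

Lemma open_homeo_image_subset (X : topologicalType) (K O : set X) :
  compact K -> open O -> open [set S : homeo X | S @` K `<=` O].
Proof.
move=> cK oO.
exact: (open_comp (fun S _ => @initial_continuous _ _ set_val S)
  (compact_open_open cK oO)).
Qed.

(* Inverses are compared too, so that agreeing sequences have bijective limits. *)
Definition homeo_agree m (S T : homeo cantor_space) : Prop :=
  forall x, agree m (S x) (T x) /\ agree m (homeo_inv S x) (homeo_inv T x).

Lemma coord_clopen i b : clopen [set x : cantor_space | x i = b].
Proof.
split.
  by rewrite openE => x <-; exact: (near_coord i x).
rewrite -openC openE => x xb; rewrite /interior.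
by apply: filterS (near_coord i x) => y /= ->.
Qed.

Lemma near_homeo_agree m (S : homeo cantor_space) :
  \forall T \near S, homeo_agree m T S.
Proof.
have [cS' SK S'K] := homeo_invP S.
have cS := @homeo_continuous _ S.
have comp A : closed A -> compact (A : set cantor_space).
  by move=> cA; apply: (subclosed_compact cA cantor_space_compact).
have nS A B : closed A -> open B -> (forall x, A x -> B (S x)) ->
    \forall T \near S, forall x, A x -> B ((T : homeo cantor_space) x).
  move=> cA oB AB.
  have nA : nbhs S [set T : homeo cantor_space | T @` A `<=` B].
    apply: open_nbhs_nbhs; split.
      exact: open_homeo_image_subset (comp _ cA) oB.
    by move=> _ [x Ax <-]; exact: AB.
  apply: (@filterS _ (nbhs S) _ _ _ _ nA) => T TAB x Ax.
  by apply: TAB; exists x.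
have pre f i b : continuous f ->
    clopen ((f : cantor_space -> cantor_space) @^-1` [set x | x i = b]).
  by move=> cf; apply: clopen_comp => //; exact: coord_clopen.
have ne : forall i, \forall T \near S, forall x,
    (T : homeo cantor_space) x i = S x i /\ homeo_inv T x i = homeo_inv S x i.
  move=> i.
  have n1 b : \forall T \near S, forall x,
      S x i = b -> (T : homeo cantor_space) x i = b.
    by apply: (nS _ [set y | y i = b]); 
      [case: (pre _ i b cS)|case: (coord_clopen i b)|].
  have n2 b : \forall T \near S, forall x, x i = b ->
      homeo_inv S ((T : homeo cantor_space) x) i = b.
    apply: (nS [set x | x i = b] [set y | homeo_inv S y i = b]).
    - by case: (coord_clopen i b).
    - by case: (pre _ i b cS').
    - by move=> x /=; rewrite SK.
  near=> T; move=> x; split.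
    by case e : (S x i); move: x e; near: T; exact: n1.
  have [_ _ T'K] := homeo_invP T; rewrite -[in RHS](T'K x).
  by apply/esym; case e : (homeo_inv T x i); move: (homeo_inv T x) e; near: T;
    exact: n2.
have := near_forall_ltn m (nbhs_filter S) ne.
by apply: filterS => T TS x; split=> i /TS/(_ x)[].
Unshelve. all: by end_near. Qed.

Lemma nbhs_homeo_agree (S : homeo cantor_space) (A : set (homeo cantor_space)) :
  nbhs S A -> exists m, forall T, homeo_agree m T S -> A T.
Proof.
move=> [_ [[U oU <-] US] UA].
have [m mU] := compact_open_agree (@homeo_continuous _ S) oU US.
by exists m => T TS; apply: UA; apply: mU => x; case: (TS x).
Qed.

Section agreeing_sequences.
Variable m : nat -> nat.
Hypothesis m_ge : forall n, (n <= m n)%N.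

Definition agreeing (f : nat -> cantor_space -> cantor_space) : Prop :=
  forall n k x, (n <= k)%N -> agree (m n) (f k x) (f n x).

Definition agreeing_lim (f : nat -> cantor_space -> cantor_space) :
  cantor_space -> cantor_space := fun x i => f i.+1 x i.

Lemma agreeing_lim_agree f n x :
  agreeing f -> agree (m n) (agreeing_lim f x) (f n x).
Proof.
move=> af i im; have [ni|/ltnW ni] := leqP n i.+1; first exact: af ni _ im.
by apply/esym; exact: af ni _ (m_ge i.+1).
Qed.

Lemma agreeing_lim_continuous f :
  (forall n, continuous (f n)) -> continuous (agreeing_lim f).
Proof.
move=> cf; apply: continuous_coord => x i.
exact: (cf i.+1 x _ (near_coord i (f i.+1 x))).
Qed.

Lemma agreeing_lim_cancel f g : agreeing f -> agreeing g ->
  (forall n, continuous (g n)) -> (forall n, cancel (f n) (g n)) ->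
  cancel (agreeing_lim f) (agreeing_lim g).
Proof.
move=> af ag cg fg x; apply/funext => i.
have [p gp] := near_agree_comp (agreeing_lim f x) i (cg i.+1).
pose k := maxn p i.+1.
rewrite {1}/agreeing_lim -(gp (f k x)).
  rewrite -[in RHS](fg k x); apply/esym; apply: (ag i.+1 k) => //.
    exact: leq_maxr.
apply/agree_sym/agree_leq/agreeing_lim_agree => //.
exact: leq_trans (leq_maxl _ _) (m_ge k).
Qed.

Lemma homeo_agree_lim (F : nat -> homeo cantor_space) :
  (forall n k, (n <= k)%N -> homeo_agree (m n) (F k) (F n)) ->
  exists L, forall n, homeo_agree (m n) L (F n).
Proof.
move=> aF; pose f n : cantor_space -> cantor_space := F n.
pose g n := homeo_inv (F n).
have af : agreeing f by move=> n k x /aF/(_ x)[].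
have ag : agreeing g by move=> n k x /aF/(_ x)[].
have cf n : continuous (f n) by exact: homeo_continuous.
have cg n : continuous (g n) by case: (homeo_invP (F n)).
have fK n : cancel (f n) (g n) by case: (homeo_invP (F n)).
have gK n : cancel (g n) (f n) by case: (homeo_invP (F n)).
have LK := agreeing_lim_cancel af ag cg fK.
have hL : is_homeo (agreeing_lim f).
  split; first exact: agreeing_lim_continuous.
  exists (agreeing_lim g); split=> //; first exact: agreeing_lim_continuous.
  exact: agreeing_lim_cancel.
exists (homeo_mk hL) => n x; split; first exact: agreeing_lim_agree.
have [_ _ invK] := homeo_invP (homeo_mk hL).
have -> : homeo_inv (homeo_mk hL) x = agreeing_lim g x.
  by rewrite -[in RHS](invK x) [RHS]LK.
exact: agreeing_lim_agree.
Qed.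

End agreeing_sequences.

Lemma homeo_agree_trans m n S T U : (m <= n)%N ->
  homeo_agree n S T -> homeo_agree m T U -> homeo_agree m S U.
Proof.
move=> mn ST TU x; have [ST1 ST2] := ST x; have [TU1 TU2] := TU x.
by split; [apply: agree_trans TU1|apply: agree_trans TU2];
  exact: agree_leq mn _.
Qed.

Lemma homeo_agree_refl m S : homeo_agree m S S.
Proof. by move=> x; split. Qed.

Lemma homeo_cantor_Baire (U : nat -> set (homeo cantor_space)) :
  (forall n, open (U n) /\ dense (U n)) -> dense (\bigcap_n U n).
Proof.
move=> odU V [S0 VS0] oV.
pose P n (p q : homeo cantor_space * nat) := (p.2 < q.2)%N /\
  forall T, homeo_agree q.2 T q.1 -> U n T /\ homeo_agree p.2 T p.1.
have next (a : nat * (homeo cantor_space * nat)) : exists q, P a.1 a.2 q.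
  case: a => n [S m] /=; have [oU dU] := odU n.
  have : nbhs S [set T | homeo_agree m T S] := near_homeo_agree m S.
  rewrite nbhsE => -[Q [oQ QS] QU].
  have [T [QT UT]] := dU Q (ex_intro _ S QS) oQ.
  have [p pT] := nbhs_homeo_agree
    (open_nbhs_nbhs (conj (openI oQ oU) (conj QT UT))).
  exists (T, maxn p m.+1); split=> /= [|T' TT']; first exact: leq_maxr.
  have [|QT' UT'] := pT T'; last by split=> //; exact: QU.
  by move=> x; have [? ?] := TT' x; split; apply: agree_leq (leq_maxl p m.+1) _.
have [f fP] := choice next.
have [m0 m0V] := nbhs_homeo_agree (open_nbhs_nbhs (conj oV VS0)).
pose s n := iteri n (fun k p => f (k, p)) (S0, m0).
have sP n : P n (s n) (s n.+1) by exact: fP.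
have s_ge n : (n <= (s n).2)%N.
  by elim: n => // n IH; have [lt _] := sP n; exact: leq_ltn_trans lt.
have s_agree n k : (n <= k)%N ->
    ((s n).2 <= (s k).2)%N /\ homeo_agree (s n).2 (s k).1 (s n).1.
  elim: k => [|k IH].
    by rewrite leqn0 => /eqP ->; split=> //; exact: homeo_agree_refl.
  rewrite leq_eqVlt => /predU1P[->|/IH[le ag]].
    by split=> //; exact: homeo_agree_refl.
  have [lt kP] := sP k; split; first exact: leq_trans le (ltnW lt).
  apply: homeo_agree_trans le _ ag.
  by have [_] := kP _ (homeo_agree_refl _ _).
have [L LP] := homeo_agree_lim s_ge (fun n k nk => proj2 (s_agree n k nk)).
exists L; split; first exact: m0V (LP 0%N).
by move=> n _; have [_ /(_ L (LP n.+1))[]] := sP n.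
Qed.

(* 1w -> 11w, 01w -> 10w, 00w -> 0w *)
Definition pushright (x : cantor_space) : cantor_space := fun i =>
  if x 0%N then (if i is j.+1 then x j else true)
  else if x 1%N then (if i is j.+2 then x i else i == 0%N)
  else x i.+1.

Definition pushleft (x : cantor_space) : cantor_space := fun i =>
  if ~~ x 0%N then (if i is j.+1 then x j else false)
  else if ~~ x 1%N then (if i is j.+2 then x i else i == 1%N)
  else x i.+1.

Lemma pushright_homeo : is_homeo pushright.
Proof.
have cont (f : cantor_space -> cantor_space) :
    (forall x y i, agree i.+2 y x -> f y i = f x i) -> continuous f.
  move=> fP; apply: continuous_coord => x i.
  by apply: filterS (near_agree i.+2 x) => y; exact: fP.
split; [|exists pushleft; split].
- apply: cont => x y i yx; rewrite /pushright !yx //.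
  by case: i yx => [|[|i]] yx //; rewrite !yx ?ltnS ?leqW.
- apply: cont => x y i yx; rewrite /pushleft !yx //.
  by case: i yx => [|[|i]] yx //; rewrite !yx ?ltnS ?leqW.
- move=> x; apply/funext => i; rewrite /pushleft /pushright.
  case x0: (x 0%N); case x1: (x 1%N) => //=; rewrite ?x0 ?x1 //=;
    by case: i => [|[|i]].
- move=> x; apply/funext => i; rewrite /pushleft /pushright.
  case x0: (x 0%N); case x1: (x 1%N) => //=; rewrite ?x0 ?x1 //=;
    by case: i => [|[|i]].
Qed.

Lemma generic_not_locally_periodic (T : homeo cantor_space) :
  generic T -> ~ locally_periodic T.
Proof.
move=> [U [odU UT]] perT.
pose A := [set x : cantor_space | x 0%N = true].
pose y : cantor_space := fun i => i == 1%N.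
have [oA cA] : clopen A := coord_clopen 0 true.
pose V := [set S : homeo cantor_space | S @` A `<=` A /\ S @` [set y] `<=` A].
have oV : open V.
  apply: openI; apply: open_homeo_image_subset => //.
    exact: subclosed_compact cA cantor_space_compact _.
  exact: compact_set1.
have V0 : V !=set0.
  exists (homeo_mk pushright_homeo); split=> _ [x xE <-].
  - by change (pushright x 0%N = true); rewrite /pushright (xE : x 0%N = true).
  - by rewrite (xE : x = y).
have [S [[SA Sy] US]] := homeo_cantor_Baire odU V0 oV.
have perS := locally_periodic_conjugate (UT _ US) perT.
apply: (locally_periodic_trap perS (conj oA cA) (x := y)) => //.
- by move=> x Ax; apply: SA; exists x.
- by apply: Sy; exists y.
Qed.

Theorem theorem4p2 (R : realType) (S : homeo cantor_space)
    (hS : Fraisse_limit (@classK R)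
            (Cstructure (@Cfun_comp R cantor_space S))) :
  [/\ forall d : cantor_space -> cantor_space -> R,
        compatible_metric d -> ~ lifting_property id d S,
      forall d : cantor_space -> cantor_space -> R,
        compatible_metric d -> ~ lifting_property factorial d S
    & forall T : homeo cantor_space, generic T -> ~ conjugate S T].
Proof.
have [lim _ _] := hS.
have perS := inductive_limit_locally_periodic cantor_space_compact lim.
split=> [d _ lift|d _ lift|T genT ST].
- exact: (lifting_property_not_locally_periodic point _ lift perS).
- by apply: (lifting_property_not_locally_periodic point _ lift perS) => n _;
    exact: fact_gt0.
- exact: generic_not_locally_periodic genT (locally_periodic_conjugate ST perS).
Qed.
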